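(* Let $K\subseteq\mathbb{R}^n$ be an extended second order cone, $L\subseteq\mathbb{R}^n$ a linear subspace and $c\in\mathbb{R}^n$, and let $(K,L,c)$ be a weakly infeasible problem. Then there are a subspace $L'\subseteq L$ and $c'\in L+c$ such that $(K,L',c')$ is weakly infeasible and the dimension of $L'+c'$ is at most $m$, where $m$ is the number of Lorentz cones among the factors of $K$.
   Context: The Lorentz cone in $\mathbb{R}^{k}$ is $\mathcal{K}^{k}=\{x\in\mathbb{R}^{k}\mid x_0\ge\|\overline{x}\|\}$, where $x=(x_0,\ldots,x_{k-1})$, $\overline{x}=(x_1,\ldots,x_{k-1})$ and $\|\cdot\|$ is the Euclidean norm; $\mathcal{K}^1=\{x\in\mathbb{R}\mid x\ge 0\}$. For $d\in\mathbb{R}^k$, $H_d^k=\{x\in\mathbb{R}^k\mid d^Tx\ge 0\}$ and $\mathrm{h}_d^k=\{\alpha d\mid\alpha\ge 0\}$. An extended second order cone is a direct product $K=K^{n_1}\times\cdots\times K^{n_q}\subseteq\mathbb{R}^n$, $n=n_1+\cdots+n_q$, where each $K^{n_i}\subseteq\mathbb{R}^{n_i}$ is one of: $\{0\}$; $\mathbb{R}^{n_i}$; the Lorentz cone $\mathcal{K}^{n_i}$; a half-space $H_d^{n_i}$ with $d\in\mathcal{K}^{n_i}\setminus\{0\}$; a half-line $\mathrm{h}_d^{n_i}$ with $d\in\mathcal{K}^{n_i}$. The number of Lorentz cones is the number of indices $i$ with $K^{n_i}=\mathcal{K}^{n_i}$. For a closed convex cone $K$, a linear subspace $L$ of $\mathbb{R}^n$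 and $c\in\mathbb{R}^n$, $(K,L,c)$ denotes the feasibility problem: find $x\in K\cap(L+c)$. It is weakly infeasible if $K\cap(L+c)=\emptyset$ but the (Euclidean) distance between $K$ and $L+c$ is $0$. *)

(* Defs.v *)
From HB Require Import structures.
From mathcomp Require Import all_boot all_order all_algebra.
From mathcomp Require Import boolp classical_sets reals constructive_ereal ereal.
Set Implicit Arguments.
Unset Strict Implicit.
Unset Printing Implicit Defensive.
Import Order.TTheory GRing.Theory Num.Theory.
Local Open Scope classical_set_scope.
Local Open Scope ring_scope.

Definition dotp (R : realType) (n : nat) (x y : 'rV[R]_n) : R :=
  \sum_j x 0 j * y 0 j.

(* The norm `|x| that the library puts on matrices is the sup norm. *)
Definition enorm (R : realType) (n : nat) (x : 'rV[R]_n) : R :=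
  Num.sqrt (dotp x x).

(* R^k with k >= 1 is 'rV[R]_k'.+1, so that the coordinate x_0 exists;
   col' 0 x is (x_1, ..., x_{k-1}). *)
Definition lorentz_cone (R : realType) (k : nat) : set 'rV[R]_k.+1 :=
  [set x | enorm (col' 0 x) <= x 0 0].
Arguments lorentz_cone : clear implicits.

Definition half_space (R : realType) (n : nat) (d : 'rV[R]_n) : set 'rV[R]_n :=
  [set x | 0 <= dotp d x].

Definition half_line (R : realType) (n : nat) (d : 'rV[R]_n) : set 'rV[R]_n :=
  [set a *: d | a in [set b : R | 0 <= b]].

Variant is_esoc_factor (R : realType) (k : nat) : set 'rV[R]_k.+1 -> Prop :=
  | esoc_zero : is_esoc_factor [set 0]
  | esoc_full : is_esoc_factor setT
  | esoc_lorentz : is_esoc_factor (lorentz_cone R k)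
  | esoc_half_space d :
      lorentz_cone R k d -> d != 0 -> is_esoc_factor (half_space d)
  | esoc_half_line d : lorentz_cone R k d -> is_esoc_factor (half_line d).

(* A point of R^n, n = n_1 + ... + n_q, is a single row vector of length
   \sum_i n_i; submxrow x i is its i-th block of coordinates. *)
Definition product_cone (R : realType) (q : nat) (k : 'I_q -> nat)
    (K : forall i, set 'rV[R]_(k i).+1) : set 'rV[R]_(\sum_i (k i).+1) :=
  [set x | forall i, K i (submxrow x i)].

(* Counts the indices whose factor is the Lorentz cone as a set, so a
   half-line or half-space of R^1 equal to [0, +oo[ is counted as well. *)
Definition lorentz_count (R : realType) (q : nat) (k : 'I_q -> nat)
    (K : forall i, set 'rV[R]_(k i).+1) : nat :=
  #|[pred i | `[< K i = lorentz_cone R (k i) >]]|.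

Definition translate (R : realType) (n : nat) (L : {vspace 'rV[R]_n})
    (c : 'rV[R]_n) : set 'rV[R]_n :=
  [set l + c | l in [set` L]].

Definition set_dist (R : realType) (n : nat) (A B : set 'rV[R]_n) : \bar R :=
  ereal_inf [set (enorm (x - y))%:E | x in A & y in B].

Definition weakly_infeasible (R : realType) (n : nat) (K : set 'rV[R]_n)
    (L : {vspace 'rV[R]_n}) (c : 'rV[R]_n) : Prop :=
  K `&` translate L c = set0 /\ set_dist K (translate L c) = 0%E.

(* Main.v *)
Require Import Defs.
From HB Require Import structures.
From mathcomp Require Import all_boot all_order all_algebra.
From mathcomp Require Import boolp classical_sets reals constructive_ereal ereal.
From mathcomp Require Import functions set_interval topology normedtype.
From mathcomp Require Import lra ring.
Set Implicit Arguments.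
Unset Strict Implicit.
Unset Printing Implicit Defensive.
Import Order.TTheory GRing.Theory Num.Theory.
Import numFieldNormedType.Exports.
Local Open Scope classical_set_scope.
Local Open Scope ring_scope.

(** The cone K and the affine space L + c are at distance zero exactly when c is
    in the closure of the Minkowski sum L + K ([set_dist0P]).  It is therefore
    enough to find L' <= L of dimension at most m and l in L such that c + l is
    in the closure of L' + K: emptiness of K and L' + (c + l) is inherited from
    that of K and L + c.  In this form the claim makes sense, and holds, whether
    or not the original problem is feasible, which is what lets an induction on
    the number m of Lorentz cones go through ([dimension_reduction]).

    Write K = C + Q_1 + ... + Q_m, where C is the sum of the polyhedral factors,
    a finitely generated cone, and the Q_i are the Lorentz factors, all embedded
    in the ambient space ([product_coneE]).  There are two cases
    ([closed_or_recession]).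

    - L + K is closed.  Then c is in L + K, a translate of c along L is in K, and
      L' = 0 works.  This settles m = 0, since finitely generated cones are closed
      ([closed_fg_cone]).

    - L + K is not closed.  Adding the Q_i one at a time to the closed cone L + C,
      some step destroys closedness.  A closed cone plus a cone with compact base
      S is closed unless the opposite of a point of S is in the former
      ([closed_sumset_rays]); so there are a nonzero a in some Q_i and r in the
      sum of C and the other Q_j such that g = a + r is in L.  Replace Q_i by its
      tangent cone T at a, the closure of Q_i + R a.  For a Lorentz cone T is a
      half-space or the whole space, hence finitely generated
      ([lorentz_base_tangent_relaxation]), and m has dropped by one.  The
      induction hypothesis gives L'' of dimension at most m - 1 for the relaxed
      cone, and L' = L'' + R g works for K: a point of T is, up to an arbitrarily
      small error, a point of Q_i plus a multiple of a, and that multiple can be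
      traded for a multiple of g, the difference being absorbed by the cones.

    The same compactness lemma proves that finitely generated cones are closed, by
    induction on the generators: if adding the half-line of g might destroy
    closedness, then -g is already in the cone, and adding the half-line amounts
    to adding the whole line R g to the lineality space. *)

(** * Minkowski sums and convex cones *)

Section MinkowskiSum.
Variable V : zmodType.
Implicit Types A B C : set V.

Definition sumset A B : set V := [set x + y | x in A & y in B].

Lemma mem_sumset A B x y : A x -> B y -> sumset A B (x + y).
Proof. by move=> Ax By; exists x => //; exists y. Qed.

Lemma sumsetC : commutative sumset.
Proof.
by move=> A B; apply/seteqP; split=> _ [x Ax [y By <-]]; rewrite addrC;
  exact: mem_sumset.
Qed.

Lemma sumsetA : associative sumset.
Proof.
move=> A B C; apply/seteqP; split.
  move=> _ [x Ax [_ [y By [z Cz <-]] <-]]; rewrite addrA.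
  by do !apply: mem_sumset.
move=> _ [_ [x Ax [y By <-]] [z Cz <-]]; rewrite -addrA.
by do !apply: mem_sumset.
Qed.

Lemma sum0set : left_id [set 0] sumset.
Proof.
move=> A; apply/seteqP; split=> [_ [_ -> [y Ay <-]]|x Ax]; first by rewrite add0r.
by rewrite -[x]add0r; apply: mem_sumset.
Qed.

HB.instance Definition _ :=
  Monoid.isComLaw.Build (set V) [set 0] sumset sumsetA sumsetC sum0set.

Lemma sumsetS A A' B B' : A `<=` A' -> B `<=` B' -> sumset A B `<=` sumset A' B'.
Proof. by move=> AA BB _ [x /AA Ax [y /BB By <-]]; exact: mem_sumset. Qed.

End MinkowskiSum.

Section ConvexCones.
Variables (R : realType) (V : lmodType R).
Implicit Types A B : set V.

Definition convex_cone A := [/\ A 0, forall x y, A x -> A y -> A (x + y)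
  & forall (t : R) x, 0 <= t -> A x -> A (t *: x)].

Lemma convex_cone0 : convex_cone [set 0].
Proof.
by split=> // [x y -> ->|t x _ ->]; rewrite /= ?addr0 ?scaler0.
Qed.

Lemma convex_cone_sumset A B :
  convex_cone A -> convex_cone B -> convex_cone (sumset A B).
Proof.
move=> [A0 AD AZ] [B0 BD BZ]; split.
- by rewrite -[0]addr0; apply: mem_sumset.
- move=> _ _ [x Ax [y By <-]] [x' Ax' [y' By' <-]]; rewrite addrACA.
  by apply: mem_sumset; [exact: AD|exact: BD].
- move=> t _ t0 [x Ax [y By <-]]; rewrite scalerDr.
  by apply: mem_sumset; [exact: AZ|exact: BZ].
Qed.

Lemma convex_cone_bigsum (I : Type) (s : seq I) (P : pred I) (A : I -> set V) :
  (forall i, P i -> convex_cone (A i)) ->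
  convex_cone (\big[@sumset V/[set 0]]_(i <- s | P i) A i).
Proof.
by move=> cA; apply: big_ind => //; [exact: convex_cone0|exact: convex_cone_sumset].
Qed.

End ConvexCones.

(** * Closedness of sums of cones *)

Section Closures.
Variables (R : realType) (n : nat).
Local Notation V := 'rV[R]_n.
Implicit Types A B C S : set V.

Lemma linear_rV_continuous m (f : {linear 'rV[R]_m -> 'rV[R]_n}) : continuous f.
Proof.
have -> : (f : _ -> _) = fun v : 'rV[R]_m => \sum_j v 0 j *: f (delta_mx 0 j).
  apply/funext => v; rewrite {1}(row_sum_delta v) linear_sum.
  by apply: eq_bigr => j _; rewrite linearZ.
apply: continuous_big => [|j _]; first exact: add_continuous.
by move=> v; apply: cvgZr_tmp; [exact: nbhs_filter|exact: coord_continuous].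
Qed.

Lemma closure_sumset A B : sumset (closure A) (closure B) `<=` closure (sumset A B).
Proof.
move=> _ [x Ax [y By <-]] N /(add_continuous (x, y)) [[N1 N2] /= [xN1 yN2] sub].
have [x' [Ax' N1x']] := Ax _ xN1; have [y' [By' N2y']] := By _ yN2.
by exists (x' + y'); split; [exact: mem_sumset|apply: (sub (x', y'))].
Qed.

(** If x is not in A + S, then for each s in S the point x - s has a neighbourhood
    that misses the closed set A; compactness makes these uniform in s. *)
Lemma closed_sumset_compact A S : closed A -> compact S -> closed (sumset A S).
Proof.
move=> clA /compact_near_coveringP cS x clx; apply: contrapT => nx.
have : \forall z \near x, S `<=` (fun s => ~ A (z - s)).
  apply: (cS V (nbhs x) (fun z s => ~ A (z - s))) => s Ss.
  have oA : open (~` A) by exact: closed_openC.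
  have : nbhs (x - s) (~` A).
    apply: open_nbhs_nbhs; split => // Axs; apply: nx.
    by rewrite -[x](subrK s); exact: mem_sumset.
  move=> /(@sub_continuous _ (x, s) _) [[N1 N2] /= [xN1 sN2] sub].
  by exists (N2, N1) => // -[s' z] /= [? ?]; apply: (sub (z, s')).
move=> /clx [_ [[a Aa [s Ss <-]] /(_ s Ss)]]; apply.
by rewrite addrK.
Qed.

Definition rays S : set V := [set t *: s | t in [set t : R | 0 <= t] & s in S].

(** Since 0 is not in the closed set A + S, the norms of a + s are bounded below
    by some d > 0, so those of a + t s by t d.  Near a given point only bounded
    values of t matter, and the rays may be replaced by a compact set. *)
Lemma closed_sumset_rays A S : closed A -> convex_cone A -> compact S ->
  (forall s, S s -> ~ A (- s)) -> closed (sumset A (rays S)).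
Proof.
move=> clA [A0 AD AZ] cS nAS.
have [d d0 dP] : exists2 d : R, 0 < d & forall s a, S s -> A a -> d <= `|a + s|.
  have n0 : ~ sumset A S 0.
    move=> [a Aa [s Ss /eqP]]; rewrite addr_eq0 => /eqP as_.
    by apply: (nAS _ Ss); rewrite -as_.
  have /closed_openC oAS := closed_sumset_compact clA cS.
  have /nbhs_ballP[d /= d0 sub] : nbhs (0 : V) (~` sumset A S).
    by apply: open_nbhs_nbhs; split.
  exists d => // s a Ss Aa; rewrite leNgt; apply/negP => lt.
  apply: (sub (a + s)); last exact: mem_sumset.
  by rewrite -ball_normE /ball_ /= sub0r normrN.
have bnd s a t : S s -> A a -> 0 <= t -> t * d <= `|a + t *: s|.
  move=> Ss Aa; rewrite le_eqVlt => /predU1P[<-|t0]; first by rewrite mul0r.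
  have -> : a + t *: s = t *: (t^-1 *: a + s).
    by rewrite scalerDr scalerA divff ?scale1r // gt_eqF.
  rewrite normrZ gtr0_norm // ler_pM2l //; apply: dP => //.
  by apply: AZ; rewrite // invr_ge0 ltW.
move=> x clx; pose M := (`|x| + 1) / d.
pose T := (fun p : R * V => p.1 *: p.2) @` (`[0, M] `*` S).
have cT : compact T.
  apply: continuous_compact; last first.
    by apply: compact_setX => //; exact: segment_compact.
  apply: continuous_subspaceT => p; exact: scale_continuous.
have sT : T `<=` rays S.
  move=> _ [[t s] /= [tM Ss] <-]; move: tM; rewrite in_itv/= => /andP[t0 _].
  by exists t => //; exists s.
apply: (@sumsetS _ A A _ _ _ sT) => //; apply: (closed_sumset_compact clA cT).
move=> N xN; have : nbhs x (N `&` ball x 1).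
  by apply: filterI => //; exact: nbhsx_ballx.
move=> /clx[_ [[a Aa [_ [t /= t0 [s Ss <-]] <-]] [Nz]]].
rewrite -ball_normE /ball_ /= => xz; exists (a + t *: s); split => //.
apply: mem_sumset => //; exists (t, s) => //=; split => //.
rewrite in_itv/= t0 /= /M ler_pdivlMr //; apply: le_trans (bnd s a t _ _ _) _ => //.
have -> : a + t *: s = x - (x - (a + t *: s)) by rewrite subKr.
apply: le_trans (ler_normB _ _) _; lra.
Qed.

End Closures.
Local Notation "\sumset_ ( i <- s ) A" := (\big[@sumset _/[set 0]]_(i <- s) A)
  (at level 41, A at level 41, i at level 50).

(** * Finitely generated cones *)

Section FinitelyGeneratedCones.
Variables (R : realType) (n : nat).
Local Notation V := 'rV[R]_n.
Implicit Types (A B C : set V) (U W : {vspace V}) (gs : seq V).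

Lemma convex_cone_vspace U : convex_cone [set` U].
Proof.
by split=> [|x y|t x _] /=; [exact: mem0v|exact: memvD|exact: memvZ].
Qed.

Lemma convex_cone_half_line (g : V) : convex_cone (half_line g).
Proof.
split; first by exists 0; rewrite /= ?scale0r.
- move=> _ _ [a /= a0 <-] [b /= b0 <-]; exists (a + b); rewrite /= ?scalerDl //.
  exact: addr_ge0.
- move=> t _ t0 [a /= a0 <-]; exists (t * a); rewrite /= ?scalerA //.
  exact: mulr_ge0.
Qed.

Lemma vspace0E : [set` (0 : {vspace V})%VS] = [set 0].
Proof. by apply/seteqP; split=> x /=; rewrite memv0 => /eqP. Qed.

Lemma closed_vspace U : closed [set` U].
Proof.
have -> : [set` U] = (\1 - projv U)%VF @^-1` [set 0].
  apply/seteqP; split=> x /=; rewrite add_lfunE opp_lfunE id_lfunE.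
    by move=> xU; rewrite projv_id // subrr.
  by move=> /eqP; rewrite subr_eq0 => /eqP ->; exact: memv_proj.
apply: closed_comp => [x _|]; first exact: linear_rV_continuous.
by apply: compact_closed; [exact: norm_hausdorff|exact: compact_set1].
Qed.

Lemma sumset_vspace U W : sumset [set` U] [set` W] = [set` (U + W)%VS].
Proof.
apply/seteqP; split=> [_ [u Uu [w Ww <-]]|x /= /memv_addP[u Uu [w Ww ->]]].
  exact: memv_add.
exact: mem_sumset.
Qed.

(** The lineality part U is kept apart from the generators because the proof of
    closedness moves a generator g into U when -g is in the cone. *)
Definition fg_cone U gs : set V :=
  sumset [set` U] (\sumset_(g <- gs) half_line g).

Definition finitely_generated C := exists U gs, C = fg_cone U gs.

Lemma convex_fg_cone U gs : convex_cone (fg_cone U gs).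
Proof.
apply: convex_cone_sumset; first exact: convex_cone_vspace.
by apply: convex_cone_bigsum => g _; exact: convex_cone_half_line.
Qed.

Lemma sumset_fg_cone U W gs hs :
  sumset (fg_cone U gs) (fg_cone W hs) = fg_cone (U + W) (gs ++ hs).
Proof. by rewrite /fg_cone big_cat -sumset_vspace /= Monoid.mulmACA. Qed.

Lemma fg_cone_vspace U : fg_cone U [::] = [set` U].
Proof. by rewrite /fg_cone big_nil Monoid.mulm1. Qed.

Lemma fg_cone_half_line g : fg_cone 0 [:: g] = half_line g.
Proof.
by rewrite /fg_cone big_seq1 vspace0E sum0set.
Qed.

(** Either -g is not in the cone of the other generators, and the half-line of g,
    which has the compact base {g}, can be added; or it is, and then the half-line
    of g generates the same cone as the line R g, which joins U. *)
Lemma closed_fg_cone U gs : closed (fg_cone U gs).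
Proof.
elim: gs U => [|g gs IH] U; first by rewrite fg_cone_vspace; exact: closed_vspace.
have -> : fg_cone U (g :: gs) = sumset (fg_cone U gs) (half_line g).
  by rewrite /fg_cone big_cons (sumsetC (half_line g)) sumsetA.
have [Cg|nCg] := pselect (fg_cone U gs (- g)); last first.
  have -> : half_line g = rays [set g].
    by apply/seteqP; split=> [_ [a a0 <-]|_ [a a0 [_ -> <-]]]; exists a => //; exists g.
  apply: closed_sumset_rays; [exact: IH|exact: convex_fg_cone|exact: compact_set1|].
  by move=> _ ->.
suff -> : sumset (fg_cone U gs) (half_line g) = fg_cone (U + <[g]>) gs by exact: IH.
have -> : fg_cone (U + <[g]>) gs = sumset (fg_cone U gs) [set` <[g]>%VS].
  by rewrite -[X in sumset _ X]fg_cone_vspace sumset_fg_cone cats0.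
have [C0 CD CZ] := convex_fg_cone U gs.
apply/seteqP; split.
  apply: sumsetS => // _ [a _ <-]; exact/memvZ/memv_line.
move=> _ [x Cx [_ /vlineP[t ->] <-]]; have [t0|t0] := leP 0 t.
  by apply: mem_sumset => //; exists t.
rewrite -[_ + _]addr0; apply: mem_sumset; last by exists 0 => //=; rewrite scale0r.
by apply: CD => //; rewrite -[g]opprK scalerN -scaleNr; apply: CZ => //; lra.
Qed.

Lemma finitely_generated_vspace U : finitely_generated [set` U].
Proof. by exists U, [::]; rewrite fg_cone_vspace. Qed.

Lemma finitely_generated0 : finitely_generated [set 0 : V].
Proof. by rewrite -vspace0E; exact: finitely_generated_vspace. Qed.

Lemma finitely_generatedT : finitely_generated [set: V].
Proof.
rewrite -[setT](_ : [set` fullv] = _); first exact: finitely_generated_vspace.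
by apply/seteqP; split=> // x _; exact: memvf.
Qed.

Lemma finitely_generated_half_line g : finitely_generated (half_line g).
Proof. by exists 0%VS, [:: g]; rewrite fg_cone_half_line. Qed.

Lemma finitely_generated_sumset A B :
  finitely_generated A -> finitely_generated B -> finitely_generated (sumset A B).
Proof.
by move=> [U [gs ->]] [W [hs ->]]; rewrite sumset_fg_cone; exists (U + W)%VS, (gs ++ hs).
Qed.

Lemma finitely_generated_closed C : finitely_generated C -> closed C.
Proof. by move=> [U [gs ->]]; exact: closed_fg_cone. Qed.

Lemma finitely_generated_convex C : finitely_generated C -> convex_cone C.
Proof. by move=> [U [gs ->]]; exact: convex_fg_cone. Qed.

End FinitelyGeneratedCones.

(** * The induction on the number of round cones *)

Section DimensionReduction.
Variables (R : realType) (n : nat).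
Local Notation V := 'rV[R]_n.
Implicit Types (C Q T : set V) (L : {vspace V}).

(** The closure of Q + R a is the tangent cone of Q at a.  A cone T squeezed
    between Q and this closure is as good as the tangent cone itself, and leaves
    only an inclusion to check. *)
Definition tangent_relaxation Q a T := [/\ finitely_generated T, Q `<=` T &
  T `<=` closure (sumset Q [set` <[a]>%VS])].

(** What the induction uses about a Lorentz cone: it has a compact base, and its
    tangent cones at the points of that base are polyhedral.  Unlike Lorentz cones
    themselves, such cones are stable under linear maps, which is needed to embed
    the factors in the product space. *)
Definition round_cone Q := convex_cone Q /\
  exists S, [/\ compact S, Q = rays S &
    forall a, S a -> exists T, tangent_relaxation Q a T].

Variables (I : eqType) (A : I -> set V).

(** The cones A i are added to C one at a time; s1 lists those added before the
    closedness criterion of [closed_sumset_rays] first fails. *)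
Lemma closed_or_recession (s : seq I) C :
  closed C -> convex_cone C -> (forall i, i \in s -> round_cone (A i)) ->
  closed (sumset C (\sumset_(i <- s) A i)) \/
  exists s1 i s2 a T, [/\ s = s1 ++ i :: s2, A i a, tangent_relaxation (A i) a T &
    sumset C (\sumset_(j <- s1) A j) (- a)].
Proof.
elim: s C => [|i s IH] C clC cvC rA; first by left; rewrite big_nil Monoid.mulm1.
have [cvA [S [cS AE rS]]] := rA i (mem_head _ _).
have [[a [Sa Ca]]|nex] := pselect (exists a, S a /\ C (- a)).
  right; have [T aT] := rS a Sa; exists [::], i, s, a, T; split => //.
    by rewrite AE -[a]scale1r; exists 1 => //=; exists a.
  by rewrite big_nil Monoid.mulm1.
have clCA : closed (sumset C (A i)).
  rewrite AE; apply: closed_sumset_rays => // a Sa Ca; apply: nex; by exists a.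
case: (IH (sumset C (A i))) => //.
- exact: convex_cone_sumset.
- by move=> j js; apply: rA; rewrite in_cons js orbT.
- by rewrite big_cons sumsetA; left.
- move=> [s1 [j [s2 [a [T [-> Aa aT Ca]]]]]]; right; exists (i :: s1), j, s2, a, T.
  by split => //; rewrite big_cons sumsetA.
Qed.

(** Each step trades one round cone for a tangent cone of it and one dimension of
    L'.  The generality in C is needed since it absorbs the tangent cones. *)
Lemma dimension_reduction (s : seq I) C L c :
  (forall i, i \in s -> round_cone (A i)) -> finitely_generated C ->
  closure (sumset [set` L] (sumset C (\sumset_(i <- s) A i))) c ->
  exists (L' : {vspace V}) l, [/\ (L' <= L)%VS, l \in L, (\dim L' <= size s)%N &
    closure (sumset [set` L'] (sumset C (\sumset_(i <- s) A i))) (c + l)].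
Proof.
have [m] := ubnP (size s); elim: m s C c => // m IH s C c sm rA fC clc.
have fLC := finitely_generated_sumset (finitely_generated_vspace L) fC.
have [] := closed_or_recession (finitely_generated_closed fLC)
  (finitely_generated_convex fLC) rA.
  rewrite -sumsetA => /closure_id; move: clc => /[swap] <- [l Ll [x Kx <-]].
  exists 0%VS, (- l); split; rewrite ?sub0v ?rpredN ?dimv0 // addrAC subrr.
  apply: subset_closure; apply: mem_sumset => //=; exact: mem0v.
move=> [s1 [i [s2 [a [T [sE Aa [fT AT Tcl]]]]]]].
rewrite -sumsetA => -[l0 Ll0 [_ [p Cp [r1 s1r1 <-]] aE]].
pose g := a + (p + r1).
have Lg : g \in L by rewrite /g -[a]opprK -aE opprD addrNK rpredN.
have rA' j : j \in s1 ++ s2 -> round_cone (A j).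
  rewrite mem_cat => js; apply: rA; rewrite sE mem_cat in_cons.
  by case/orP: js => ->; rewrite ?orbT.
pose Rs := \sumset_(j <- s1 ++ s2) A j.
have cvRs : convex_cone Rs.
  rewrite /Rs big_seq; apply: convex_cone_bigsum => j js; by case: (rA' j js).
have cvA : convex_cone (A i) by case: (rA i); rewrite // sE mem_cat mem_head orbT.
have sumE : \sumset_(j <- s) A j = sumset Rs (A i).
  by rewrite sE /Rs !big_cat big_cons /= (sumsetC (A i)) sumsetA.
have Rsr1 : Rs r1.
  have [R20 _ _] : convex_cone (\sumset_(j <- s2) A j).
    rewrite big_seq; apply: convex_cone_bigsum => j js.
    by case: (rA' j); rewrite // mem_cat js orbT.
  by rewrite /Rs big_cat -[r1]addr0; exact: mem_sumset.
have size_s : size s = (size (s1 ++ s2)).+1 by rewrite sE !size_cat addnS.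
have sub L' : sumset [set` L'] (sumset (sumset C T) Rs) `<=`
    closure (sumset [set` (L' + <[g]>)%VS] (sumset C (\sumset_(j <- s) A j))).
  (* T is the only summand that has to be approximated. *)
  have -> : sumset [set` L'] (sumset (sumset C T) Rs) =
      sumset (sumset [set` L'] (sumset C Rs)) T.
    by rewrite -(sumsetA C) (sumsetC T) !sumsetA.
  suff sub0 : sumset (sumset [set` L'] (sumset C Rs)) (sumset (A i) [set` <[a]>%VS])
      `<=` sumset [set` (L' + <[g]>)%VS] (sumset C (sumset Rs (A i))).
    rewrite sumE => x xs; apply: (closure_subset sub0); apply: closure_sumset.
    by move: xs; apply: sumsetS => //; exact: subset_closure.
  move=> _ [_ [l2 Ll2 [_ [p' Cp' [r' Rr' <-]] <-]] [_ [y Ay [_ /vlineP[t ->] <-]] <-]].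
  have [C0 CD CZ] := finitely_generated_convex fC.
  have [R0 RD RZ] := cvRs; have [_ AD AZ] := cvA.
  have [t0|t0] := leP 0 t.
    rewrite -!addrA; apply: mem_sumset.
      by rewrite -[l2]addr0; apply: memv_add => //; exact: mem0v.
    by do !apply: mem_sumset => //; apply: AD => //; exact: AZ.
  (* For t < 0 the point t a need not be in A i; as a = g - (p + r1), it equals
     t g + (- t) (p + r1), and the cones C and Rs absorb the second term. *)
  have -> : l2 + (p' + r') + (y + t *: a) =
      (l2 + t *: g) + ((p' + - t *: p) + ((r' + - t *: r1) + y)).
    by apply/rowP => j; rewrite /g !mxE; ring.
  have nt0 : 0 <= - t by lra.
  apply: mem_sumset; first by apply: memv_add => //; exact/memvZ/memv_line.
  by do !apply: mem_sumset => //; [apply: CD => //; exact: CZ|apply: RD => //; exact: RZ].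
have [|||| L' [l [LL' Ll dimL' cl']]] := IH (s1 ++ s2) (sumset C T) c.
- by rewrite -ltnS -size_s.
- exact: rA'.
- exact: finitely_generated_sumset.
- apply: closure_subset clc; rewrite sumE (sumsetC Rs) (sumsetA C).
  by do 2!apply: sumsetS => //; exact: sumsetS.
exists (L' + <[g]>)%VS, l; split => //.
- apply/subvP => _ /memv_addP[u /(subvP LL') Lu [_ /vlineP[t ->] ->]].
  by rewrite rpredD ?rpredZ.
- apply: leq_trans (dimv_add_leqif _ _) _.
  by rewrite size_s -[X in (_ <= X)%N]addn1 leq_add // dim_vline leq_b1.
- by rewrite ((closure_id _).1 (@closed_closure _ _)); move: cl'; apply: closure_subset.
Qed.

End DimensionReduction.

(** * The dot product and half-spaces *)

Section DotProduct.
Variables (R : realType) (n : nat).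
Implicit Types x y z : 'rV[R]_n.

Lemma dotpC x y : dotp x y = dotp y x.
Proof. by apply: eq_bigr => j _; rewrite mulrC. Qed.

Lemma dotpDr x y z : dotp x (y + z) = dotp x y + dotp x z.
Proof. by rewrite -big_split; apply: eq_bigr => j _; rewrite mxE mulrDr. Qed.

Lemma dotpZr t x y : dotp x (t *: y) = t * dotp x y.
Proof. by rewrite mulr_sumr; apply: eq_bigr => j _; rewrite mxE mulrCA. Qed.

Lemma dotpDl x y z : dotp (x + y) z = dotp x z + dotp y z.
Proof. by rewrite dotpC dotpDr !(dotpC z). Qed.

Lemma dotpZl t x y : dotp (t *: x) y = t * dotp x y.
Proof. by rewrite dotpC dotpZr dotpC. Qed.

Lemma dotp_ge0 x : 0 <= dotp x x.
Proof. by apply: sumr_ge0 => j _; rewrite -expr2 sqr_ge0. Qed.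

Lemma sqr_coord_le_dotp x j : x 0 j ^+ 2 <= dotp x x.
Proof.
rewrite /dotp (bigD1 j) //= -expr2 lerDl.
by apply: sumr_ge0 => i _; rewrite -expr2 sqr_ge0.
Qed.

Lemma dotp_eq0 x : dotp x x = 0 -> x = 0.
Proof.
move=> x0; apply/rowP => j; rewrite mxE; apply/eqP.
by rewrite -sqrf_eq0 eq_le sqr_ge0 -x0 sqr_coord_le_dotp.
Qed.

Lemma cauchy_schwarz x y : dotp x y ^+ 2 <= dotp x x * dotp y y.
Proof.
have := dotp_ge0 y; rewrite le_eqVlt => /predU1P[/esym y0|y0].
  by rewrite [y]dotp_eq0 // -[0](scale0r 0) !dotpZr !mul0r mulr0 expr0n.
have := dotp_ge0 (dotp y y *: x + - dotp x y *: y).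
rewrite !(dotpDl, dotpDr, dotpZl, dotpZr) (dotpC y x).
set a := dotp x x; set b := dotp x y; set d := dotp y y => h.
have : 0 <= d * (a * d - b ^+ 2) by lra.
by rewrite pmulr_rge0 // subr_ge0.
Qed.

Lemma norm_le_enorm x : `|x| <= enorm x.
Proof.
suff : mx_norm x <= enorm x by [].
have [->|x0] := eqVneq (mx_norm x) 0; first exact: sqrtr_ge0.
have [[i j] /= ->] := mx_norm_neq0 x0.
by rewrite -sqrtr_sqr ler_wsqrtr // ord1 sqr_coord_le_dotp.
Qed.

End DotProduct.

(** Reindexing by h covers both the squared norm of x and that of its tail. *)
Lemma continuous_sum_sqr (R : realType) m n (h : 'I_m -> 'I_n) :
  continuous (fun x : 'rV[R]_n => \sum_j x 0 (h j) * x 0 (h j)).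
Proof.
apply: continuous_big => [|j _]; first exact: add_continuous.
by move=> x; apply: continuousM; exact: coord_continuous.
Qed.

(** The half-space is the sum of the hyperplane orthogonal to d and the half-line
    of d; for d = 0 the hyperplane is everything. *)
Lemma half_space_finitely_generated (R : realType) n (d : 'rV[R]_n) :
  finitely_generated (half_space d).
Proof.
pose U := lker (linfun (mulmxr d^T : 'rV[R]_n -> 'rV[R]_1)).
have UE x : (x \in U) = (dotp d x == 0).
  rewrite memv_ker lfunE /=; apply/eqP/eqP => [/rowP/(_ 0)|d0].
    by rewrite !mxE dotpC => <-; apply: eq_bigr => j _; rewrite mxE.
  apply/rowP => j; rewrite ord1 !mxE -[RHS]d0 dotpC; apply: eq_bigr => i _.
  by rewrite mxE.
suff -> : half_space d = sumset [set` U] (half_line d).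
  apply: finitely_generated_sumset; first exact: finitely_generated_vspace.
  exact: finitely_generated_half_line.
apply/seteqP; split=> [x /= dx|]; last first.
  move=> _ [u /= + [_ [t /= t0 <-] <-]]; rewrite UE => /eqP du.
  by rewrite /half_space/= dotpDr du add0r dotpZr mulr_ge0 // dotp_ge0.
pose t := dotp d x / dotp d d.
rewrite -[x](subrK (t *: d)); apply: mem_sumset; last first.
  by exists t => //=; rewrite divr_ge0 // dotp_ge0.
rewrite /= UE -scaleNr dotpDr dotpZr mulNr subr_eq0.
have [/dotp_eq0 ->|d0] := eqVneq (dotp d d) 0.
  by rewrite -(scale0r (0 : 'rV[R]_n)) !dotpZl !mul0r mulr0.
by rewrite /t divfK.
Qed.

(** * The Lorentz cone *)

Lemma closure_segment (R : realType) n (A : set 'rV[R]_n) x d :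
  (forall e, 0 < e -> A (x + e *: d)) -> closure A x.
Proof.
move=> Ad N /nbhs_ballP[r /= r0 rN]; pose e := r / (`|d| + 1).
have e0 : 0 < e by rewrite divr_gt0 // ltr_wpDl.
exists (x + e *: d); split; first exact: Ad.
apply: rN; rewrite -ball_normE /ball_ /= opprD addrA subrr sub0r normrN.
rewrite normrZ gtr0_norm // /e mulrAC ltr_pdivrMr ?ltr_wpDl //.
by rewrite ltr_pM2l // ltrDl.
Qed.

Section LorentzCone.
Variables (R : realType) (k : nat).
Local Notation K := (lorentz_cone R k).
Local Notation V := 'rV[R]_k.+1.
Implicit Types x y a : V.

Lemma dotp_recl x y : dotp x y = x 0 0 * y 0 0 + dotp (col' 0 x) (col' 0 y).
Proof.
by rewrite /dotp big_ord_recl; congr (_ + _); apply: eq_bigr => j _; rewrite !mxE.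
Qed.

Lemma lorentz_coneE x : K x <-> 0 <= x 0 0 /\ dotp (col' 0 x) (col' 0 x) <= x 0 0 ^+ 2.
Proof.
rewrite /lorentz_cone/= /enorm; split=> [h|[x0 xx]]; last first.
  by rewrite -[leRHS]ger0_norm // -sqrtr_sqr ler_wsqrtr.
have x0 : 0 <= x 0 0 by apply: le_trans h; exact: sqrtr_ge0.
by split=> //; rewrite -[leLHS]sqr_sqrtr ?dotp_ge0 // lerXn2r ?nnegrE ?sqrtr_ge0.
Qed.

Lemma col'D x y : col' 0 (x + y) = col' 0 x + col' 0 y.
Proof. by apply/rowP => j; rewrite !mxE. Qed.

Lemma col'Z t x : col' 0 (t *: x) = t *: col' 0 x.
Proof. by apply/rowP => j; rewrite !mxE. Qed.

Lemma lorentz_cone_dotp x y : K x -> K y ->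
  dotp (col' 0 x) (col' 0 y) <= x 0 0 * y 0 0.
Proof.
move=> /lorentz_coneE[x0 xx] /lorentz_coneE[y0 yy].
apply: le_trans (ler_norm _) _.
rewrite -(@ler_pXn2r _ 2) ?nnegrE ?normr_ge0 ?mulr_ge0 // real_normK ?num_real //.
apply: le_trans (cauchy_schwarz _ _) _.
by rewrite exprMn ler_pM ?dotp_ge0.
Qed.

Lemma convex_lorentz_cone : convex_cone K.
Proof.
split.
- apply/lorentz_coneE; rewrite mxE expr0n.
  by rewrite -(scale0r (0 : V)) col'Z dotpZl mul0r.
- move=> x y Kx Ky; have xy := lorentz_cone_dotp Kx Ky.
  move: Kx Ky => /lorentz_coneE[x0 xx] /lorentz_coneE[y0 yy].
  apply/lorentz_coneE; rewrite col'D !mxE addr_ge0 //; split => //.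
  rewrite !(dotpDl, dotpDr) (dotpC (col' 0 y)); nra.
- move=> t x t0 /lorentz_coneE[x0 xx]; apply/lorentz_coneE.
  rewrite col'Z !mxE mulr_ge0 //; split => //.
  by rewrite dotpZl dotpZr mulrA -expr2 exprMn ler_wpM2l // sqr_ge0.
Qed.

Definition lorentz_base : set V :=
  [set x : V | x 0 0 = 1 /\ dotp (col' 0 x) (col' 0 x) <= 1].

(** When x_0 = 0 the tail of x vanishes, so any point of the base serves. *)
Lemma lorentz_cone_rays : K = rays lorentz_base.
Proof.
apply/seteqP; split=> [x /lorentz_coneE[]|].
  rewrite le_eqVlt => /predU1P[/esym x0|x0] xx.
    exists 0 => //=; exists (delta_mx 0 0).
      split; first by rewrite mxE.
      rewrite [X in dotp X _](_ : _ = 0 *: 0) ?dotpZl ?mul0r //.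
      by rewrite scale0r; apply/rowP => j; rewrite !mxE.
    rewrite scale0r; apply/rowP => j; rewrite mxE.
    have /dotp_eq0/rowP xb : dotp (col' 0 x) (col' 0 x) = 0.
      by apply/eqP; rewrite eq_le dotp_ge0 andbT (le_trans xx) // x0 expr0n.
    by case: (unliftP 0 j) => [i|] ->; [have := xb i; rewrite !mxE|].
  exists (x 0 0); first exact: ltW.
  exists ((x 0 0)^-1 *: x); last by rewrite scalerA divff ?scale1r // gt_eqF.
  split; first by rewrite mxE mulVf // gt_eqF.
  by rewrite col'Z dotpZl dotpZr mulrA -invfM ler_pdivrMl ?mulr1 ?mulr_gt0 // -expr2.
move=> _ [t /= t0 [s [s0 ss] <-]].
have [_ _] := convex_lorentz_cone; apply => //.
by apply/lorentz_coneE; rewrite s0 expr1n.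
Qed.

Lemma compact_lorentz_base : compact lorentz_base.
Proof.
apply: bounded_closed_compact.
  exists 2; split; first exact: num_real.
  move=> M M2 x [x0 xx]; apply: le_trans (norm_le_enorm x) _.
  have M0 : 0 <= M by lra.
  rewrite /enorm -[leRHS]ger0_norm // -sqrtr_sqr ler_wsqrtr // dotp_recl x0.
  nra.
have -> : lorentz_base = (fun x : V => x 0 0) @^-1` [set 1] `&`
    (fun x : V => \sum_j x 0 (lift 0 j) * x 0 (lift 0 j)) @^-1` [set r | r <= 1].
  have tailE (x : V) : dotp (col' 0 x) (col' 0 x) = \sum_j x 0 (lift 0 j) * x 0 (lift 0 j).
    by apply: eq_bigr => j _; rewrite !mxE.
  by rewrite /lorentz_base; apply/seteqP; split=> x /= []; rewrite tailE => x0 xx; split.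
apply: closedI; apply: closed_comp => [x _|].
- exact: coord_continuous.
- by apply: compact_closed; [exact: norm_hausdorff|exact: compact_set1].
- exact: continuous_sum_sqr.
- exact: closed_le.
Qed.

(** Along the line x + t a, the function x_0^2 - |tail x|^2 is the quadratic
    polynomial q + 2 t B + t^2 e of t, where e is its value at a and B is the
    Lorentzian product of x and a.  If a is interior, then e > 0 and every x is in
    K + R a.  If a is on the boundary, then e = 0, and x is in K + R a as soon as
    B > 0; the relaxation is the half-space B >= 0, and its boundary is
    reached by moving slightly along its normal a' = (1, - tail a). *)
Lemma lorentz_base_tangent_relaxation a :
  lorentz_base a -> exists T, tangent_relaxation K a T.
Proof.
move=> [a0 aa].
have reach x t : 0 <= x 0 0 + t ->
    0 <= x 0 0 ^+ 2 - dotp (col' 0 x) (col' 0 x)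
      + 2 * t * (x 0 0 - dotp (col' 0 x) (col' 0 a))
      + t ^+ 2 * (1 - dotp (col' 0 a) (col' 0 a)) ->
    sumset K [set` <[a]>%VS] x.
  move=> xt qt; rewrite -[x](addrK (t *: a)); apply: mem_sumset; last first.
    by rewrite /= memvN; exact/memvZ/memv_line.
  apply/lorentz_coneE; rewrite col'D col'Z !mxE a0 mulr1; split => //.
  rewrite !(dotpDl, dotpDr, dotpZl, dotpZr) (dotpC (col' 0 a) (col' 0 x)).
  lra.
move: aa; rewrite le_eqVlt => /predU1P[aa|aa]; last first.
  exists setT; split => //.
    exact: finitely_generatedT.
  move=> x _; apply: subset_closure.
  set q := x 0 0 ^+ 2 - dotp (col' 0 x) (col' 0 x).
  set B := x 0 0 - dotp (col' 0 x) (col' 0 a).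
  set e := 1 - dotp (col' 0 a) (col' 0 a).
  have e0 : 0 < e by rewrite subr_gt0.
  (* The first term makes the quadratic part dominate, the others ensure that
     x_0 + t >= 0 and t >= 1. *)
  pose t := (2 * `|B| + `|q|) / e + `|x 0 0| + 1.
  have te : 2 * `|B| + `|q| <= t * e.
    have -> : t * e = 2 * `|B| + `|q| + (`|x 0 0| + 1) * e.
      by rewrite /t; field; rewrite gt_eqF.
    have := mulr_ge0 (normr_ge0 (x 0 0)) (ltW e0); lra.
  have tx : 0 <= (2 * `|B| + `|q|) / e by rewrite divr_ge0 ?(ltW e0) // addr_ge0 // mulr_ge0.
  have x0 := normr_ge0 (x 0 0).
  have t1 : 1 <= t by rewrite /t; lra.
  apply: (reach x t).
    by have := ler_norm (- x 0 0); rewrite normrN /t; lra.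
  rewrite -/q -/B -/e.
  have := ler_norm (- q); have := ler_norm (- B); rewrite !normrN => Bn qn.
  have q0 := normr_ge0 q. have B0 := normr_ge0 B.
  nra.
pose a' : V := \row_j (if j == 0 then 1 else - a 0 j).
have a'E x : dotp a' x = x 0 0 - dotp (col' 0 x) (col' 0 a).
  rewrite dotp_recl mxE eqxx mul1r; congr (_ + _).
  rewrite -sumrN; apply: eq_bigr => j _.
  by rewrite !mxE eq_sym (negbTE (neq_lift _ _)) mulNr mulrC.
exists (half_space a'); split; first exact: half_space_finitely_generated.
  move=> x Kx; rewrite /half_space/= a'E subr_ge0.
  apply: le_trans (lorentz_cone_dotp Kx _) _; last by rewrite a0 mulr1.
  by apply/lorentz_coneE; rewrite a0 aa expr1n.
move=> x; rewrite /half_space/= => a'x; apply: (@closure_segment _ _ _ x a') => e e0.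
have : 0 < dotp a' (x + e *: a').
  rewrite dotpDr dotpZr ltr_wpDl // mulr_gt0 //.
  by apply: lt_le_trans (sqr_coord_le_dotp _ 0); rewrite mxE eqxx expr1n.
move: (x + e *: a') => {a'x e e0}x; rewrite a'E.
set q := x 0 0 ^+ 2 - dotp (col' 0 x) (col' 0 x).
set B := x 0 0 - dotp (col' 0 x) (col' 0 a) => B0.
pose t := `|q| / B + `|x 0 0|.
have tB : `|q| <= t * B.
  have -> : t * B = `|q| + `|x 0 0| * B by rewrite /t; field; rewrite gt_eqF.
  have := mulr_ge0 (normr_ge0 (x 0 0)) (ltW B0); lra.
have q0 : 0 <= `|q| / B by rewrite divr_ge0 // ltW.
have xn := ler_norm (- x 0 0); have qn := ler_norm (- q); rewrite !normrN in xn qn.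
apply: (reach x t); first by rewrite /t; lra.
rewrite -/q -/B aa subrr mulr0 addr0; have := normr_ge0 q; nra.
Qed.

Lemma round_lorentz_cone : round_cone K.
Proof.
split; first exact: convex_lorentz_cone.
exists lorentz_base; split; [exact: compact_lorentz_base|exact: lorentz_cone_rays|].
exact: lorentz_base_tangent_relaxation.
Qed.

End LorentzCone.

(** * Linear images and block decomposition *)

Section LinearImages.
Variables (R : realType) (m n : nat) (f : {linear 'rV[R]_m -> 'rV[R]_n}).
Implicit Types (A B C Q T S : set 'rV[R]_m).

Lemma image_sumset A B : f @` sumset A B = sumset (f @` A) (f @` B).
Proof.
apply/seteqP; split=> [_ [_ [x Ax [y By <-]] <-]|_ [_ [x Ax <-] [_ [y By <-] <-]]].
  by rewrite linearD; apply: mem_sumset; [exists x|exists y].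
by exists (x + y); [exact: mem_sumset|rewrite linearD].
Qed.

Lemma image_vspace (U : {vspace 'rV[R]_m}) : f @` [set` U] = [set` (linfun f @: U)%VS].
Proof.
apply/seteqP; split=> [_ [x /= Ux <-]|_ /= /memv_imgP[x Ux ->]].
  by rewrite -[f x]lfunE memv_img.
by exists x; rewrite ?lfunE.
Qed.

Lemma image_half_line g : f @` half_line g = half_line (f g).
Proof.
apply/seteqP; split=> [_ [_ [a a0 <-] <-]|_ [a a0 <-]].
  by exists a; rewrite ?linearZ.
by exists (a *: g); [exists a|rewrite linearZ].
Qed.

Lemma finitely_generated_image C :
  finitely_generated C -> finitely_generated (f @` C).
Proof.
move=> [U [gs ->]]; exists (linfun f @: U)%VS, (map f gs).
rewrite /fg_cone image_sumset image_vspace; congr sumset.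
elim: gs => [|g gs IH]; first by rewrite !big_nil image_set1 linear0.
by rewrite /= !big_cons image_sumset image_half_line IH.
Qed.

Lemma convex_cone_image C : convex_cone C -> convex_cone (f @` C).
Proof.
move=> [C0 CD CZ]; split; first by exists 0; rewrite ?linear0.
- move=> _ _ [x Cx <-] [y Cy <-]; exists (x + y); [exact: CD|exact: linearD].
- move=> t _ t0 [x Cx <-]; exists (t *: x); [exact: CZ|exact: linearZ].
Qed.

Lemma image_rays S : f @` rays S = rays (f @` S).
Proof.
apply/seteqP; split=> [_ [_ [t t0 [s Ss <-]] <-]|_ [t t0 [_ [s Ss <-] <-]]].
  by exists t => //; exists (f s); [exists s|rewrite linearZ].
by exists (t *: s); [exists t => //; exists s|rewrite linearZ].
Qed.

Lemma image_closure A : f @` closure A `<=` closure (f @` A).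
Proof.
move=> _ [x Ax <-] N /linear_rV_continuous/Ax[y [Ay Ny]].
by exists (f y); split=> //; exists y.
Qed.

Lemma round_cone_image Q : round_cone Q -> round_cone (f @` Q).
Proof.
move=> [cvQ [S [cS QE Srel]]]; split; first exact: convex_cone_image.
exists (f @` S); split.
- apply: continuous_compact => //; apply: continuous_subspaceT => x.
  exact: linear_rV_continuous.
- by rewrite QE image_rays.
- move=> _ [a Sa <-]; have [T [fT QT Tcl]] := Srel a Sa.
  exists (f @` T); split; [exact: finitely_generated_image|exact: image_subset|].
  have -> : sumset (f @` Q) [set` <[f a]>%VS] = f @` sumset Q [set` <[a]>%VS].
    by rewrite image_sumset image_vspace limg_line lfunE.
  by apply: subset_trans (@image_closure _); exact: image_subset.
Qed.

End LinearImages.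

Section Blocks.
Variables (R : realType) (q : nat) (k : 'I_q -> nat).
Local Notation V := 'rV[R]_(\sum_i (k i).+1).

(** Multiplication by a block of rows of the identity matrix, which spares the
    casts that a blockwise definition would require. *)
Definition block_inj (i : 'I_q) : {linear 'rV[R]_(k i).+1 -> V} :=
  mulmxr (submxcol 1%:M i).

Lemma submxrow_block_inj i v : submxrow (block_inj i v) i = v.
Proof.
by rewrite /= -mul_submxrow -submxblockEv -mxdiagZ submxblock_diag mulmx1.
Qed.

Lemma submxrow_block_inj0 i j v : i != j -> submxrow (block_inj i v) j = 0.
Proof.
move=> ij; rewrite /= -mul_submxrow -submxblockEv -mxdiagZ /mxdiag mxblockK.
by rewrite (negbTE ij) mulmx0.
Qed.

Lemma sum_block_inj (x : V) : \sum_i block_inj i (submxrow x i) = x.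
Proof.
by rewrite /= -mul_mxrow_mxcol submxrowK submxcolK mulmx1.
Qed.

Lemma product_coneE (K : forall i, set 'rV[R]_(k i).+1) :
  (forall i, convex_cone (K i)) ->
  product_cone K = \big[@sumset V/[set 0]]_i (block_inj i @` K i).
Proof.
move=> cK; apply/seteqP; split=> [x Kx|].
  rewrite -[x]sum_block_inj.
  apply: (big_ind2 (fun (y : V) (A : set V) => A y)) => //.
  - by move=> y1 A1 y2 A2 *; exact: mem_sumset.
  - by move=> i _; exists (submxrow x i).
apply: (big_ind (fun A : set V => A `<=` product_cone K)).
- by move=> _ -> i; rewrite submxrow0; case: (cK i).
- move=> A B AK BK _ [x /AK Kx [y /BK Ky <-]] i; rewrite submxrowD.
  by case: (cK i) => _ KD _; exact: KD.
- move=> i _ _ [v Kv <-] j; have [<-|ij] := eqVneq i j.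
    by rewrite submxrow_block_inj.
  by rewrite submxrow_block_inj0 //; case: (cK j).
Qed.

End Blocks.

(** * Distance zero and the main result *)

Section Distance.
Variables (R : realType) (n : nat).
Implicit Types (K : set 'rV[R]_n) (L : {vspace 'rV[R]_n}) (c : 'rV[R]_n).

(** L absorbs the change of sign that turns K - L into L + K. *)
Lemma set_dist0P K L c :
  set_dist K (translate L c) = 0%E <-> closure (sumset [set` L] K) c.
Proof.
split=> [d0 N /nbhs_ballP[r /= r0 rN]|clc].
  have : (set_dist K (translate L c) < r%:E)%E by rewrite d0 lte_fin.
  move=> /ereal_inf_lt[_ [x Kx [_ [l Ll <-] <-]]]; rewrite lte_fin => xr.
  exists (- l + x); split; first by apply: mem_sumset; rewrite //= memvN.
  apply: rN; rewrite -ball_normE /ball_ /=; apply: le_lt_trans xr.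
  have -> : c - (- l + x) = - (x - (l + c)) by apply/rowP => j; rewrite !mxE; ring.
  by rewrite normrN; exact: norm_le_enorm.
apply/eqP; rewrite eq_le; apply/andP; split; last first.
  by apply: le_ereal_inf_tmp => _ [x Kx [y Ly <-]]; rewrite lee_fin sqrtr_ge0.
apply/lee_addgt0Pr => e e0; rewrite add0e.
have /nbhs_ballP[r /= r0 small] : \forall z \near (0 : 'rV[R]_n), dotp z z < e ^+ 2.
  apply: (@continuous_sum_sqr _ _ _ id 0 (fun t => t < e ^+ 2)).
  apply: open_nbhs_nbhs; split; first exact: open_lt.
  by rewrite /= big1 ?exprn_gt0 // => j _; rewrite mxE mulr0.
have [_ [[l Ll [x Kx <-]]]] := clc _ (nbhsx_ballx c _ r0).
rewrite -ball_normE /ball_ /= distrC => xr.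
have xe : dotp (l + x - c) (l + x - c) < e ^+ 2.
  by apply: small; rewrite -ball_normE /ball_ /= sub0r normrN.
apply: ge_ereal_inf; exists (enorm (x - (- l + c)))%:E.
  by exists x => //; exists (- l + c) => //; exists (- l) => //=; rewrite memvN.
rewrite lee_fin -[leRHS]gtr0_norm // -sqrtr_sqr ler_wsqrtr //.
by rewrite opprD opprK addrA (addrC x) ltW.
Qed.

End Distance.

(** Factors are sorted by equality with the Lorentz cone, as in the definition
    of the count, so that a half-line or half-space of dimension one equal to it
    is treated as a Lorentz cone. *)
Lemma finitely_generated_factor (R : realType) k (K : set 'rV[R]_k.+1) :
  is_esoc_factor K -> K <> lorentz_cone R k -> finitely_generated K.
Proof.
case=> [||//|d _ _|d _] _; last exact: finitely_generated_half_line.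
- exact: finitely_generated0.
- exact: finitely_generatedT.
- exact: half_space_finitely_generated.
Qed.

Theorem theorem9 (R : realType) (q : nat) (k : 'I_q -> nat)
    (K : forall i : 'I_q, set 'rV[R]_(k i).+1)
    (HK : forall i : 'I_q, is_esoc_factor (K i))
    (L : {vspace 'rV[R]_(\sum_i (k i).+1)})
    (c : 'rV[R]_(\sum_i (k i).+1))
    (Hwi : weakly_infeasible (product_cone K) L c) :
  exists (L' : {vspace 'rV[R]_(\sum_i (k i).+1)})
         (c' : 'rV[R]_(\sum_i (k i).+1)),
    [/\ (L' <= L)%VS,
        translate L c c',
        weakly_infeasible (product_cone K) L' c' &
        (\dim L' <= lorentz_count K)%N].
Proof.
have [empty /set_dist0P clc] := Hwi.
have cvK i : convex_cone (K i).
  have [->|nK] := pselect (K i = lorentz_cone R (k i)).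
    exact: convex_lorentz_cone.
  exact/finitely_generated_convex/finitely_generated_factor.
pose P := [pred i | `[< K i = lorentz_cone R (k i) >]].
pose A i := @block_inj R q k i @` K i.
pose C := \big[@sumset _/[set 0]]_(i | ~~ P i) A i.
have KE : product_cone K = sumset C (\sumset_(i <- enum P) A i).
  by rewrite product_coneE // [LHS](bigID P) /= sumsetC big_enum.
have rA i : i \in enum P -> round_cone (A i).
  rewrite mem_enum => /asboolP KiE; apply: round_cone_image; rewrite KiE.
  exact: round_lorentz_cone.
have fC : finitely_generated C.
  apply: big_ind; [exact: finitely_generated0|exact: finitely_generated_sumset|].
  move=> i /asboolPn nK; apply: finitely_generated_image.
  exact: finitely_generated_factor.
rewrite KE in clc.
have [L' [l [LL' Ll dimL' cl']]] := dimension_reduction rA fC clc.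
exists L', (c + l); split => //; last 2 first.
- split; last by apply/set_dist0P; rewrite KE.
  apply/seteqP; split=> // x [Kx [l' Ll' xE]]; rewrite -empty; split => //.
  exists (l' + l); first by apply: memvD => //; exact: (subvP LL').
  by rewrite -xE -addrA (addrC l).
- by rewrite /lorentz_count cardE.
- by exists l => //; rewrite addrC.
Qed.
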